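(* For all integers $n,k\ge1$, $$\mathsf V(S_c^*(a_1\cdots a_k))\subseteq\mathsf V(S_c^*(a^n))\quad\Longleftrightarrow\quad n\ge2k-1.$$ Moreover, for all integers $n,k\ge 1$, $$\mathsf V(S_c^*(a^n))\subseteq\mathsf V(S_c^*(a_1\cdots a_k))\quad\Longleftrightarrow\quad n=1.$$
   Context: An ai-semiring (additively idempotent semiring) is an algebra $(S,+,\cdot)$ with two binary operations such that $(S,+)$ is a commutative idempotent semigroup, $(S,\cdot)$ is a semigroup, and both distributive laws hold. The signature is $(+,\cdot)$, with no constants. $\mathsf V(S)$ denotes the variety generated by $S$. For $n\ge 1$, $S_c^*(a^n)$ is the ai-semiring with universe $\{a,a^2,\ldots,a^n,0\}$ ($n+1$ distinct elements), where $0$ is absorbing for both addition and multiplication, $a^i+a^j=a^{\max\{i,j\}}$, and $a^i a^j=a^{i+j}$ if $i+j\le n$, $a^ia^j=0$ if $i+j>n$. For $k\ge1$ and distinct letters $a_1,\dots,a_k$, the semiring $S_c^*(a_1\cdots a_k)$ has as its nonzero elements all nonempty square-free commutative words on $\{a_1,\ldots,a_k\}$, together with an element $0$ absorbing for both addition and multiplication. For nonzero $u,v$: $u+v$ is the square-free word whose set of letters is the union of the sets of letters of $u$ and $v$; $u\cdot v$ is the square-free word $uv$ if $u$ and $v$ have no letter in common, and $u\cdot v=0$ otherwise. *)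

(* Defs.v *)
From mathcomp Require Import all_boot.
From mathcomp Require Import zify boolp.

Set Implicit Arguments.
Unset Strict Implicit.
Unset Printing Implicit Defensive.

(* As usual in universal algebra, universes of algebras are nonempty sets.
   The carrier is an arbitrary type; in particular it need not have a
   decidable equality, a zero or a one. *)
Record aiSemiring : Type := AiSemiring {
  ai_sort :> Type;
  ai_add : ai_sort -> ai_sort -> ai_sort;
  ai_mul : ai_sort -> ai_sort -> ai_sort;
  ai_nonempty : inhabited ai_sort;
  ai_addA : associative ai_add;
  ai_addC : commutative ai_add;
  ai_addxx : idempotent_op ai_add;
  ai_mulA : associative ai_mul;
  ai_mulDl : left_distributive ai_mul ai_add;
  ai_mulDr : right_distributive ai_mul ai_add
}.

Definition ai_hom (S T : aiSemiring) (f : S -> T) : Prop :=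
  {morph f : x y / ai_add x y} /\ {morph f : x y / ai_mul x y}.

Section Product.
Variables (I : Type) (A : I -> aiSemiring).

Let P := forall i, A i.
Let add (x y : P) : P := fun i => ai_add (x i) (y i).
Let mul (x y : P) : P := fun i => ai_mul (x i) (y i).

Fact prod_nonempty : inhabited P.
Proof. exact: (inhabits (fun i => inhabited_witness (ai_nonempty (A i)))). Qed.

Fact prod_addA : associative add.
Proof. move=> x y z; apply: functional_extensionality_dep => i; exact: ai_addA. Qed.

Fact prod_addC : commutative add.
Proof. move=> x y; apply: functional_extensionality_dep => i; exact: ai_addC. Qed.

Fact prod_addxx : idempotent_op add.
Proof. move=> x; apply: functional_extensionality_dep => i; exact: ai_addxx. Qed.

Fact prod_mulA : associative mul.
Proof. move=> x y z; apply: functional_extensionality_dep => i; exact: ai_mulA. Qed.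

Fact prod_mulDl : left_distributive mul add.
Proof. move=> x y z; apply: functional_extensionality_dep => i; exact: ai_mulDl. Qed.

Fact prod_mulDr : right_distributive mul add.
Proof. move=> x y z; apply: functional_extensionality_dep => i; exact: ai_mulDr. Qed.

Definition ai_prod : aiSemiring :=
  AiSemiring prod_nonempty prod_addA prod_addC prod_addxx
    prod_mulA prod_mulDl prod_mulDr.

End Product.

(* A variety is a class closed under homomorphic images, subalgebras and direct
   products.  A subalgebra is given by an injective homomorphism, i.e. up to
   isomorphism; the index set of a product may be infinite or empty. *)
Record is_variety (K : aiSemiring -> Prop) : Prop := IsVariety {
  variety_H : forall (S T : aiSemiring) (f : S -> T),
    ai_hom f -> (forall y, exists x, f x = y) -> K S -> K T;
  variety_S : forall (S T : aiSemiring) (f : S -> T),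
    ai_hom f -> injective f -> K T -> K S;
  variety_P : forall (I : Type) (A : I -> aiSemiring),
    (forall i, K (A i)) -> K (ai_prod A)
}.

(* V(S): the smallest variety containing S. *)
Definition gen_variety (S : aiSemiring) : aiSemiring -> Prop :=
  fun T => forall K, is_variety K -> K S -> K T.

Definition subclass (K L : aiSemiring -> Prop) : Prop := forall T, K T -> L T.

(* In both families below, [None] is the absorbing element 0. *)

Section Powers.
Variable n : nat.

(* [Some i] is the power a^i. *)
Definition expo : Type := {i : nat | 0 < i <= n}.

Definition pow_add (x y : option expo) : option expo :=
  match x, y with
  | Some i, Some j => Some (if val i <= val j then j else i)
  | _, _ => None
  end.

(* [insub m] is [Some] of the exponent m when 0 < m <= n, and [None] (i.e. 0)
   otherwise. *)
Definition pow_mul (x y : option expo) : option expo :=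
  match x, y with
  | Some i, Some j => insub (val i + val j)
  | _, _ => None
  end.

Let toN (x : option expo) : nat := if x is Some i then val i else n.+1.

Let toN_inj : injective toN.
Proof.
move=> [[i hi]|] [[j hj]|] //= e; try lia.
by congr Some; apply: val_inj.
Qed.

Let toN_gt0 x : 0 < toN x.
Proof. by case: x => [[i hi]|] //=; lia. Qed.

Let toN_le x : toN x <= n.+1.
Proof. by case: x => [[i hi]|] //=; lia. Qed.

Let toN_add x y : toN (pow_add x y) = maxn (toN x) (toN y).
Proof.
have := toN_le x; have := toN_le y.
by case: x y => [i|] [j|] //=; last (by lia); try case: ifP; lia.
Qed.

Let toN_mul x y : toN (pow_mul x y) = minn n.+1 (toN x + toN y).
Proof.
have := toN_gt0 x; have := toN_gt0 y.
case: x y => [i|] [j|] /= j0 i0; try lia.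
case: insubP => [u /andP[_ le_n] uE|/= nle]; last lia.
rewrite /toN uE; lia.
Qed.

Fact pow_addA : associative pow_add.
Proof. by move=> x y z; apply: toN_inj; rewrite !toN_add maxnA. Qed.

Fact pow_addC : commutative pow_add.
Proof. by move=> x y; apply: toN_inj; rewrite !toN_add maxnC. Qed.

Fact pow_addxx : idempotent_op pow_add.
Proof. by move=> x; apply: toN_inj; rewrite toN_add maxnn. Qed.

Fact pow_mulC : commutative pow_mul.
Proof. by move=> x y; apply: toN_inj; rewrite !toN_mul addnC. Qed.

Fact pow_mulA : associative pow_mul.
Proof.
move=> x y z; apply: toN_inj; rewrite !toN_mul.
lia.
Qed.

Fact pow_mulDl : left_distributive pow_mul pow_add.
Proof.
move=> x y z; apply: toN_inj; rewrite !(toN_mul, toN_add).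
lia.
Qed.

Fact pow_mulDr : right_distributive pow_mul pow_add.
Proof. by move=> x y z; rewrite !(pow_mulC x) pow_mulDl. Qed.

Definition Sc_pow : aiSemiring :=
  AiSemiring (inhabits None) pow_addA pow_addC pow_addxx
    pow_mulA pow_mulDl pow_mulDr.

End Powers.

Section Words.
Variable k : nat.

(* A nonempty square-free commutative word on a_1, ..., a_k is encoded by its
   set of letters. *)
Definition sfword : Type := {A : {set 'I_k} | A != set0}.

Fact sfword_cat_proof (u v : sfword) : val u :|: val v != set0.
Proof. by case: u => A /= hA; rewrite setU_eq0 negb_and hA. Qed.

Definition sfword_cat (u v : sfword) : sfword :=
  exist _ (val u :|: val v) (sfword_cat_proof u v).

Definition word_add (x y : option sfword) : option sfword :=
  match x, y with
  | Some u, Some v => Some (sfword_cat u v)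
  | _, _ => None
  end.

Definition word_mul (x y : option sfword) : option sfword :=
  match x, y with
  | Some u, Some v =>
      if [disjoint val u & val v] then Some (sfword_cat u v) else None
  | _, _ => None
  end.

Let catA : associative sfword_cat.
Proof. by move=> u v w; apply: val_inj; rewrite /= setUA. Qed.

Let catC : commutative sfword_cat.
Proof. by move=> u v; apply: val_inj; rewrite /= setUC. Qed.

Let catxx : idempotent_op sfword_cat.
Proof. by move=> u; apply: val_inj; rewrite /= setUid. Qed.

Fact word_addA : associative word_add.
Proof. by move=> [u|] [v|] [w|] //=; rewrite catA. Qed.

Fact word_addC : commutative word_add.
Proof. by move=> [u|] [v|] //=; rewrite catC. Qed.

Fact word_addxx : idempotent_op word_add.
Proof. by move=> [u|] //=; rewrite catxx. Qed.

Fact word_mulC : commutative word_mul.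
Proof. by move=> [u|] [v|] //=; rewrite disjoint_sym catC. Qed.

Fact word_mulA : associative word_mul.
Proof.
move=> [u|] [v|] [w|] //=; last by case: ifP.
case: (boolP [disjoint val u & val v]) => uv;
  case: (boolP [disjoint val v & val w]) => vw //=;
  rewrite -!setI_eq0 ?(setIUl, setIUr) ?setU_eq0 !setI_eq0
    ?uv ?(negbTE uv) ?vw ?(negbTE vw) ?andbF ?andbT //=.
by rewrite catA.
Qed.

Fact word_mulDl : left_distributive word_mul word_add.
Proof.
move=> [u|] [v|] [w|] //=; last by case: ifP.
rewrite -!setI_eq0 setIUl setU_eq0 !setI_eq0.
case: ifP => [/andP[-> ->] /=|].
  by rewrite -!catA (catC v w) (catA w w v) catxx (catC w v).
by case: [disjoint _ & _]; case: [disjoint _ & _].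
Qed.

Fact word_mulDr : right_distributive word_mul word_add.
Proof. by move=> x y z; rewrite !(word_mulC x) word_mulDl. Qed.

Definition Sc_word : aiSemiring :=
  AiSemiring (inhabits None) word_addA word_addC word_addxx
    word_mulA word_mulDl word_mulDr.

End Words.

(* Main.v *)
Require Import Defs.
From mathcomp Require Import all_boot.
From mathcomp Require Import zify boolp.

(** Identify the nonzero words with the nonempty subsets of {1, ..., k}, and the
    elements of S_c^*(a^n) with the exponents 1, ..., n, n+1, where n+1 stands
    for 0; addition is then the maximum, and multiplication is truncated
    addition.  For n >= 2k-1, the word A is represented in the k-th power of
    S_c^*(a^n) by the vectors f with k <= f c <= |A|-1+k for c in A and
    f c <= |A| (so f c < k) for c outside A, and 0 by the vectors with some
    entry >= 2k.  The product of representatives of words sharing a letter c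
    has an entry >= 2k at c, so the representing vectors form a subalgebra that
    maps onto S_c^*(a_1...a_k).  For n <= 2k-2, the identity
    x_1...x_k = x_1...x_k + x_1^2 separates the two: if
    x_1 + ... + x_k <= 2k-2 with all x_i >= 1, then x_1 <= k-1, hence
    2 x_1 <= x_1 + ... + x_k.  For n >= 2, the identity x^2 = x^2 + y holds in
    S_c^*(a_1...a_k), where squares vanish, but fails in S_c^*(a^n). *)

Set Implicit Arguments.
Unset Strict Implicit.
Unset Printing Implicit Defensive.

(** * Terms, identities and generated varieties *)

Inductive term : Type :=
  | Var of nat
  | Add of term & term
  | Mul of term & term.

Fixpoint eval (S : aiSemiring) (v : nat -> S) (t : term) : S :=
  match t with
  | Var i => v i
  | Add t1 t2 => ai_add (eval v t1) (eval v t2)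
  | Mul t1 t2 => ai_mul (eval v t1) (eval v t2)
  end.

Definition satisfies (s t : term) (S : aiSemiring) : Prop :=
  forall v : nat -> S, eval v s = eval v t.

Lemma eval_hom (S T : aiSemiring) (f : S -> T) (v : nat -> S) (t : term) :
  ai_hom f -> f (eval v t) = eval (f \o v) t.
Proof. by case=> fD fM; elim: t => //= t1 <- t2 <-. Qed.

(** The easy half of Birkhoff's theorem, used to refute membership in a variety. For images, a
    valuation is lifted along chosen preimages. *)
Lemma satisfies_variety (s t : term) : is_variety (satisfies s t).
Proof.
split.
- move=> S T f hf f_surj Sst v.
  have [g gK] := choice f_surj.
  have -> : v = f \o (g \o v) by apply: funext => i /=.
  by rewrite -!(eval_hom _ _ hf) Sst.
- by move=> S T f hf f_inj Tst v; apply: f_inj; rewrite !(eval_hom _ _ hf).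
- move=> I A Ast v; apply: functional_extensionality_dep => i.
  have hom_i : @ai_hom (ai_prod A) (A i) (fun x => x i) by [].
  by rewrite !(eval_hom _ _ hom_i) Ast.
Qed.

Lemma gen_variety_self (S : aiSemiring) : gen_variety S S.
Proof. by []. Qed.

Lemma subclass_gen_variety (S T : aiSemiring) :
  subclass (gen_variety S) (gen_variety T) <-> gen_variety T S.
Proof.
split=> [sub|TS U SU K K_var KT]; first exact: sub _ (@gen_variety_self S).
exact: SU K_var (TS K K_var KT).
Qed.

(** * Subquotients presented by a relation *)

Section Subquotient.
Variables (S T : aiSemiring) (R : S -> T -> Prop).
Hypothesis R_add : forall x x' y y',
  R x y -> R x' y' -> R (ai_add x x') (ai_add y y').
Hypothesis R_mul : forall x x' y y',
  R x y -> R x' y' -> R (ai_mul x x') (ai_mul y y').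
Hypothesis R_fun : forall x y y', R x y -> R x y' -> y = y'.
Hypothesis R_surj : forall y, exists x, R x y.

Let graph : Type := {p : S * T | R p.1 p.2}.

Let graph_eq (p q : graph) : proj1_sig p = proj1_sig q -> p = q.
Proof. by case: p q => [p hp] [q hq] /= e; exact: eq_exist. Qed.

Let gadd (p q : graph) : graph :=
  exist _ (ai_add (proj1_sig p).1 (proj1_sig q).1,
           ai_add (proj1_sig p).2 (proj1_sig q).2)
    (R_add (proj2_sig p) (proj2_sig q)).

Let gmul (p q : graph) : graph :=
  exist _ (ai_mul (proj1_sig p).1 (proj1_sig q).1,
           ai_mul (proj1_sig p).2 (proj1_sig q).2)
    (R_mul (proj2_sig p) (proj2_sig q)).

Let graph_inhabited : inhabited graph.
Proof.
have [y] := ai_nonempty T; have [x Rxy] := R_surj y.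
exact: (inhabits (exist _ (x, y) Rxy)).
Qed.

Let gaddA : associative gadd.
Proof. by move=> p q r; apply: graph_eq; rewrite /= !ai_addA. Qed.

Let gaddC : commutative gadd.
Proof.
by move=> p q; apply: graph_eq => /=; congr pair; apply: ai_addC.
Qed.

Let gaddxx : idempotent_op gadd.
Proof.
by move=> p; apply: graph_eq; rewrite /= !ai_addxx -surjective_pairing.
Qed.

Let gmulA : associative gmul.
Proof. by move=> p q r; apply: graph_eq; rewrite /= !ai_mulA. Qed.

Let gmulDl : left_distributive gmul gadd.
Proof. by move=> p q r; apply: graph_eq; rewrite /= !ai_mulDl. Qed.

Let gmulDr : right_distributive gmul gadd.
Proof. by move=> p q r; apply: graph_eq; rewrite /= !ai_mulDr. Qed.

Let graph_semiring : aiSemiring :=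
  AiSemiring graph_inhabited gaddA gaddC gaddxx gmulA gmulDl gmulDr.

(** The graph of [R] is a semiring under componentwise operations. Functionality of [R] makes its
    first projection an embedding into [S]; surjectivity makes the second one onto [T]. *)
Lemma variety_subquotient (K : aiSemiring -> Prop) :
  is_variety K -> K S -> K T.
Proof.
case=> K_H K_S _ KS.
have : K graph_semiring.
  apply: (K_S graph_semiring S (fun p : graph => (proj1_sig p).1)) KS => //.
  move=> [[x y] Rp] [[x' y'] Rq] /= exx'; apply: graph_eq => /=.
  by subst x'; rewrite (R_fun Rp Rq : y = y').
apply: (K_H graph_semiring T (fun p : graph => (proj1_sig p).2)) => // y.
by have [x Rxy] := R_surj y; exists (exist _ (x, y) Rxy).
Qed.

End Subquotient.

(** * Numerical coordinates on the powers of a *)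

Definition pow_val n (x : Sc_pow n) : nat := oapp val n.+1 x.

(** Every [m] outside 1, ..., n gives the zero element, including [m = 0]. *)
Definition pow_of n (m : nat) : Sc_pow n := insub m.

Section PowVal.
Variable n : nat.
Implicit Types x y : Sc_pow n.

Lemma pow_val_inj : injective (@pow_val n).
Proof.
move=> [[i hi]|] [[j hj]|] //=; rewrite /pow_val /= => e; try lia.
by congr Some; apply: val_inj.
Qed.

Lemma pow_val_gt0 x : 0 < pow_val x.
Proof. by case: x => [[i hi]|] //=; rewrite /pow_val /=; lia. Qed.

Lemma pow_val_le x : pow_val x <= n.+1.
Proof. by case: x => [[i hi]|] //=; rewrite /pow_val /=; lia. Qed.

Lemma pow_valD x y : pow_val (ai_add x y) = maxn (pow_val x) (pow_val y).
Proof.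
have := pow_val_le x; have := pow_val_le y.
by case: x y => [i|] [j|] //=; rewrite /pow_val /=; try case: ifP; lia.
Qed.

Lemma pow_valK m : 0 < m -> pow_val (pow_of n m) = minn n.+1 m.
Proof.
rewrite /pow_val /pow_of => m0.
by case: insubP => [u /andP[_ le_n] /= ->|/= nle]; lia.
Qed.

Lemma pow_valM x y :
  pow_val (ai_mul x y) = minn n.+1 (pow_val x + pow_val y).
Proof.
have := pow_val_gt0 x; have := pow_val_gt0 y.
case: x y => [i|] [j|] j0 i0; rewrite /pow_val /= in i0 j0 *; try lia.
by rewrite -/(pow_val _) -/(pow_of n _) pow_valK; lia.
Qed.

End PowVal.

(** * The word semiring as a subquotient of a power *)

Section WordInPow.
Variables n k : nat.
Hypotheses (k_gt0 : 0 < k) (le_kn : 2 * k - 1 <= n).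

Let P : aiSemiring := ai_prod (fun _ : 'I_k => Sc_pow n).

Definition represents (f : P) (w : Sc_word k) : Prop :=
  match w with
  | Some A => forall c : 'I_k,
      if c \in val A then k <= pow_val (f c) < #|val A| + k
      else pow_val (f c) <= #|val A|
  | None => exists c : 'I_k, 2 * k <= pow_val (f c)
  end.

Let word_card (A : {set 'I_k}) : #|A| <= k.
Proof. by rewrite -[X in _ <= X]card_ord max_card. Qed.

Let word_cardD1 (A : {set 'I_k}) c : c \notin A -> #|A| < k.
Proof.
move=> cA; have := word_card (c |: A); rewrite cardsU1 cA; lia.
Qed.

Let cardU_ge (A B : {set 'I_k}) : maxn #|A| #|B| <= #|A :|: B|.
Proof. by rewrite geq_max !subset_leq_card ?subsetUl ?subsetUr. Qed.

Lemma represents_add f g u w :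
  represents f u -> represents g w -> represents (ai_add f g) (ai_add u w).
Proof.
case: u w => [A|] [B|] /=.
- move=> fA gB c; have := fA c; have := gB c.
  have := cardU_ge (val A) (val B).
  rewrite pow_valD inE.
  by case cA: (c \in val A); case cB: (c \in val B) => /=; lia.
- by move=> _ [c gc]; exists c; rewrite pow_valD; lia.
- by move=> [c fc] _; exists c; rewrite pow_valD; lia.
- by move=> [c fc] _; exists c; rewrite pow_valD; lia.
Qed.

(** For disjoint words cardinalities add, and so do the bounds. At a shared letter both entries are
    at least k; truncation at n+1 >= 2k keeps their sum at least 2k. *)
Lemma represents_mul f g u w :
  represents f u -> represents g w -> represents (ai_mul f g) (ai_mul u w).
Proof.
case: u w => [A|] [B|] /=.
- move=> fA gB; case: ifP => [AB c|/negbT/pred0Pn [c /andP[/= cA cB]]].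
    have := fA c; have := gB c.
    rewrite pow_valM inE /= cardsU (disjoint_setI0 AB) cards0 subn0.
    have := word_card (val A :|: val B).
    rewrite cardsU (disjoint_setI0 AB) cards0 subn0 => leAB.
    case cA: (c \in val A); case cB: (c \in val B) => /=; try lia.
    by have := disjointFr AB cA; rewrite cB.
  exists c; have := fA c; have := gB c; rewrite cA cB pow_valM; lia.
- move=> _ [c gc]; exists c; rewrite pow_valM; lia.
- move=> [c fc] _; exists c; rewrite pow_valM; lia.
- move=> [c fc] _; exists c; rewrite pow_valM; lia.
Qed.

Let represents_mem f A c :
  represents f (Some A) -> (c \in val A) = (k <= pow_val (f c)).
Proof.
move=> /(_ c); case: ifP => [_ /andP[-> _]//|/negbT cA].
by have := word_cardD1 cA; lia.
Qed.

Let represents_lt f A c : represents f (Some A) -> pow_val (f c) < 2 * k.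
Proof.
by move=> /(_ c); have := word_card (val A); case: ifP => _; lia.
Qed.

(** The threshold k recovers the letters of a word, and the threshold 2k tells words from 0. *)
Lemma represents_fun f u w : represents f u -> represents f w -> u = w.
Proof.
case: u w => [A|] [B|] // fA fB.
- congr Some; apply: val_inj; apply/setP => c.
  by rewrite (represents_mem c fA) (represents_mem c fB).
- by case: fB => c; have := represents_lt c fA; lia.
- by case: fA => c; have := represents_lt c fB; lia.
Qed.

Lemma represents_surj w : exists f, represents f w.
Proof.
case: w => [A|].
  (* The least admissible entries; both upper bounds hold because the word is nonempty. *)
  exists (fun c => pow_of n (if c \in val A then k else 1)) => c.
  have : 0 < #|val A| by rewrite card_gt0 (valP A).
  by move=> A0; rewrite pow_valK; case: (c \in val A); lia.
exists (fun _ => None), (Ordinal k_gt0); rewrite /pow_val /=; lia.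
Qed.

Lemma word_in_pow : gen_variety (Sc_pow n) (Sc_word k).
Proof.
move=> K K_var KS.
apply: (variety_subquotient represents_add represents_mul represents_fun
  represents_surj K_var).
exact: variety_P.
Qed.

End WordInPow.

(** * Separating identities and the case n = 1 *)

Fixpoint var_prod (m : nat) : term :=
  if m is m'.+1 then Mul (var_prod m') (Var m) else Var 0.

(** Each of the [m] factors after the first raises the exponent by at least 1, up to truncation. *)
Lemma pow_var_prod n (v : nat -> Sc_pow n) m :
  minn n.+1 (pow_val (v 0) + m) <= pow_val (eval v (var_prod m)).
Proof.
elim: m => [|m IH] /=; first by rewrite addn0 geq_minr.
rewrite pow_valM; have := pow_val_gt0 (v m.+1); lia.
Qed.

Lemma pow_satisfies_prod_sq n k : n < 2 * k - 1 ->
  satisfies (var_prod k.-1) (Add (var_prod k.-1) (Mul (Var 0) (Var 0)))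
    (Sc_pow n).
Proof.
move=> lt_nk v; apply: pow_val_inj; rewrite /= pow_valD pow_valM.
(* Let x be the value of [v 0]. If x <= k-1, then 2x <= x+k-1; otherwise x+k-1 >= 2k-1 >= n+1 and
   the product is already 0. *)
by have := pow_var_prod v k.-1; lia.
Qed.

Lemma set1_neq0 (T : finType) (x : T) : [set x] != set0.
Proof. by rewrite -card_gt0 cards1. Qed.

(** A valuation must cover all variables, so indices from [k] on get the default 0. *)
Definition letter k (i : nat) : Sc_word k :=
  if insub i is Some c then Some (exist _ [set c] (set1_neq0 c)) else None.

(** The bound on the letters makes the next letter disjoint from the product so far, so the
    induction never reaches 0. *)
Lemma word_var_prod k m : m < k ->
  exists2 A, eval (letter k) (var_prod m) = Some A &
    forall c : 'I_k, c \in val A -> c <= m.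
Proof.
elim: m => [|m IH] lt_mk /=.
  rewrite /letter insubT; eexists; first by [].
  by move=> c /=; rewrite inE => /eqP ->.
have [A -> leA] := IH (ltnW lt_mk).
rewrite /letter insubT /=.
have -> : [disjoint val A & [set Sub m.+1 lt_mk : 'I_k]].
  by rewrite disjoint_sym disjoints1; apply/negP => /leA /=; rewrite ltnn.
eexists; first by [].
by move=> c /=; rewrite !inE => /orP[/leA /leqW //|/eqP ->].
Qed.

Lemma word_not_satisfies_prod_sq k : 0 < k ->
  ~ satisfies (var_prod k.-1) (Add (var_prod k.-1) (Mul (Var 0) (Var 0)))
    (Sc_word k).
Proof.
move=> k0 /(_ (letter k)) /=.
have [|A -> _] := @word_var_prod k k.-1; first by rewrite prednK.
(* A letter meets itself, so its square is 0 and absorbs the right-hand side. *)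
by rewrite /letter insubT /= -setI_eq0 setIid (negbTE (set1_neq0 _)).
Qed.

Lemma word_satisfies_sq_absorbs k :
  satisfies (Mul (Var 0) (Var 0)) (Add (Mul (Var 0) (Var 0)) (Var 1))
    (Sc_word k).
Proof.
move=> v /=; case: (v 0) => [[A A0]|] //=.
by rewrite -setI_eq0 setIid (negbTE A0).
Qed.

Lemma pow_satisfies_sq_absorbs n :
  satisfies (Mul (Var 0) (Var 0)) (Add (Mul (Var 0) (Var 0)) (Var 1))
    (Sc_pow n) -> n <= 1.
Proof.
(* With x = a and y = 0 the identity says that a^2 is 0. *)
move=> /(_ (fun i => if i is 0 then pow_of n 1 else None)) /=.
move/(congr1 (@pow_val n)); rewrite pow_valD pow_valM pow_valK //.
by rewrite [pow_val None]/=; lia.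
Qed.

(** For n = 1 the elements are a and 0, with a+a = a and aa = 0; any single letter together with 0
    is a copy of this. *)
Lemma pow1_in_word k : 0 < k -> gen_variety (Sc_word k) (Sc_pow 1).
Proof.
move=> k0 K K_var.
pose f (x : Sc_pow 1) : Sc_word k := if x is Some _ then letter k 0 else None.
have expo1 (i j : expo 1) : i = j.
  by apply: val_inj; have := valP i; have := valP j => /=; lia.
apply: (variety_S K_var (f := f)).
- rewrite /f /letter insubT; split=> [] [i|] [j|] //=.
    by congr Some; apply: val_inj; rewrite /= setUid.
  rewrite -setI_eq0 setIid (negbTE (set1_neq0 _)).
  by case: insubP => // u /andP[_]; have := valP i; have := valP j => /=; lia.
- rewrite /f /letter insubT => - [i|] [j|] //= _.
  by rewrite (expo1 i j).
Qed.

Theorem theorem8p2 :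
  (forall n k : nat, 1 <= n -> 1 <= k ->
     (subclass (gen_variety (Sc_word k)) (gen_variety (Sc_pow n))
      <-> n >= 2 * k - 1))
  /\
  (forall n k : nat, 1 <= n -> 1 <= k ->
     (subclass (gen_variety (Sc_pow n)) (gen_variety (Sc_word k))
      <-> n = 1)).
Proof.
split=> n k n0 k0; rewrite subclass_gen_variety; split.
- move=> PW; rewrite leqNgt; apply/negP => lt_nk.
  apply: (word_not_satisfies_prod_sq k0).
  exact: PW (satisfies_variety _ _) (pow_satisfies_prod_sq lt_nk).
- exact: word_in_pow.
- move=> WP; apply/eqP; rewrite eqn_leq n0 andbT.
  apply: pow_satisfies_sq_absorbs.
  exact: WP (satisfies_variety _ _) (word_satisfies_sq_absorbs (k := k)).
- by move=> ->; exact: pow1_in_word.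
Qed.
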